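(* Let $K$ be a scattered compact linearly ordered space. Then there exists a scattered compact linearly ordered space $L\in\mathcal R$ which has a two-to-one continuous order preserving map onto $K$. In particular, $K\in\mathcal{RC}$.
   Context: All spaces are completely regular Hausdorff; maps are continuous; linearly ordered sets carry the order topology. A linearly ordered set is scattered if it does not contain an order isomorphic copy of the rationals $\mathbb Q$ (for compact linearly ordered spaces this is equivalent to being topologically scattered). A map is two-to-one if each point of its range has exactly two preimages; order preserving means $x\le y\Rightarrow f(x)\le f(y)$. A retraction is a map $f\colon X\to Y$ having a right inverse, i.e. a continuous $g\colon Y\to X$ with $fg=\mathrm{id}_Y$. An inverse sequence is an inverse system $\mathbb S=\langle X_\xi,p_\xi^\eta,\lambda\rangle$ indexed by an ordinal $\lambda$. It is continuous if for every limit ordinal $\delta<\lambda$ the space $X_\delta$ together with the maps $p_\xi^\delta$ ($\xi<\delta$) is the inverse limit of $\mathbb S\restriction\delta$. $\mathcal R$ is the smallest class of compact spaces which contains all metrizable compact spaces and is closed under limits of continuous inverse sequences whose bonding maps are retractions. $\mathcal{RC}$ is the smallest class of compact spaces which contains all metrizable compact spaces and is closed both under continuous (Hausdorff) images and under limits of continuous inverse sequences whose bonding maps are retractions. *)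

(* Defs.v *)
From HB Require Import structures.
From mathcomp Require Import all_boot all_order all_algebra.
From mathcomp Require Import all_classical all_reals topology.
From mathcomp Require wochoice.

Set Implicit Arguments.
Unset Strict Implicit.
Unset Printing Implicit Defensive.

Import Order.TTheory.
Local Open Scope classical_set_scope.
Local Open Scope order_scope.

Definition scattered d (T : porderType d) : Prop :=
  ~ exists f : rat -> T, {mono f : x y / x <= y}.

Definition two_to_one (X Y : Type) (f : X -> Y) : Prop :=
  forall y, range f y -> (f @^-1` [set y] #= `I_2)%card.

Definition retraction (X Y : topologicalType) (f : X -> Y) : Prop :=
  continuous f /\ exists2 g : Y -> X, continuous g & cancel g f.

Definition homeomorphism (X Y : topologicalType) (f : X -> Y) : Prop :=
  continuous f /\ exists g : Y -> X, [/\ continuous g, cancel f g & cancel g f].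

Definition metrizable (R : realType) (X : topologicalType) : Prop :=
  exists (M : metricType R) (h : X -> M), homeomorphism h.

Record inverse_system d (I : porderType d) := InverseSystem {
  space :> I -> topologicalType;
  bond : forall i j, i <= j -> space j -> space i;
  bond_continuous : forall i j (ij : i <= j), continuous (bond ij);
  bond_id : forall i (ii : i <= i) x, bond ii x = x;
  bond_comp : forall i j k (ij : i <= j) (jk : j <= k) (ik : i <= k) x,
    bond ij (bond jk x) = bond ik x
}.

Definition threads d (I : porderType d) (S : inverse_system I) (D : set I) :
    set (prod_topology (fun i : D => S (val i))) :=
  [set x | forall (i j : D) (ij : val i <= val j), bond ij (x j) = x i].

Arguments threads {d I} S D _.

(* [X] with the projections [q] is the inverse limit of the restriction of [S]
   to [D]: [x |-> (q i x)_i] is a homeomorphism of [X] onto the space of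
   threads, a subspace of the product. *)
Definition is_inverse_limit d (I : porderType d) (S : inverse_system I)
    (D : set I) (X : topologicalType) (q : forall i, D i -> X -> S i) : Prop :=
  exists2 h : X -> set_type (threads S D), homeomorphism h &
    forall x (i : D), val (h x) i = q (val i) (set_mem (valP i)) x.

Definition limit_index d (I : porderType d) (l : I) : Prop :=
  (exists i, i < l) /\ forall i, i < l -> exists j, i < j < l.

Definition continuous_system d (I : porderType d) (S : inverse_system I) :
    Prop :=
  forall l, limit_index l ->
    @is_inverse_limit _ _ S [set i | i < l] (S l) (fun i il => bond (ltW il)).

(* An ordinal [lambda] is represented by a well-ordered set [I] of order type
   [lambda]; its limit ordinals [delta < lambda] are the [l] with
   [limit_index l]. *)
Definition limit_of_retractions d (I : orderType d) (S : inverse_system I)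
    (X : topologicalType) : Prop :=
  [/\ wochoice.well_order (fun i j : I => i <= j),
      continuous_system S,
      forall i j (ij : i <= j), retraction (@bond _ _ S i j ij) &
      exists q : forall i, X -> S i,
        @is_inverse_limit _ _ S [set: I] X (fun i _ => q i)].

Inductive class_R (R : realType) : topologicalType -> Prop :=
| class_R_metrizable (X : topologicalType) :
    compact [set: X] -> metrizable R X -> class_R R X
| class_R_limit d (I : orderType d) (S : inverse_system I)
    (X : topologicalType) :
    (forall i, class_R R (S i)) -> limit_of_retractions S X -> class_R R X.

Inductive class_RC (R : realType) : topologicalType -> Prop :=
| class_RC_metrizable (X : topologicalType) :
    compact [set: X] -> metrizable R X -> class_RC R X
| class_RC_image (X Y : topologicalType) (f : X -> Y) :
    class_RC R X -> continuous f -> range f = [set: Y] -> hausdorff_space Y ->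
    class_RC R Y
| class_RC_limit d (I : orderType d) (S : inverse_system I)
    (X : topologicalType) :
    (forall i, class_RC R (S i)) -> limit_of_retractions S X -> class_RC R X.

(* Main.v *)
(* L is the lexicographic product K x {0,1}: it is compact, scattered, and each
   of its points is an endpoint of a jump. If t_w is a continuous increasing
   well-ordered chain with supremum s, then [u, s] is the limit of the intervals
   [u, t_w] along the retractions x |-> min(x, t_w), and likewise from the right
   with max; jumps allow intervals to be concatenated as disjoint closed sets.
   Call p and q linked when every closed interval inside [p, q] is "good" (it
   can be added to sets in R without leaving R). Linkedness is then a convex
   equivalence relation with closed classes, and jumps are linked, so between
   two unlinked points there is a point linked to neither. Hence if the ends of
   L were not linked, L would contain a copy of the rationals. *)
From HB Require Import structures.
Require Import Defs.
From mathcomp Require Import all_boot all_order all_algebra.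
From mathcomp Require Import all_classical all_reals topology.
From mathcomp Require wochoice.

Set Implicit Arguments.
Unset Strict Implicit.
Unset Printing Implicit Defensive.

Import Order.TTheory.
Local Open Scope order_scope.
Local Open Scope classical_set_scope.

(** * Subspaces, homeomorphisms and invariance of the class R *)

Lemma set_type_val_continuous (X : topologicalType) (A : set X) :
  continuous (val : set_type A -> X).
Proof. exact: initial_continuous. Qed.

Lemma continuous_to_set_type (X Y : topologicalType) (A : set Y)
    (f : X -> set_type A) : continuous (val \o f) -> continuous f.
Proof. by move=> cf; apply: continuous_comp_initial. Qed.

Lemma hausdorff_set_type (X : topologicalType) (A : set X) :
  hausdorff_space X -> hausdorff_space (set_type A).
Proof.
move=> hX p q pq; apply/val_inj/hX => U V Up Vq.
have [r [Ur Vr]] : (val @^-1` U `&` val @^-1` V : set (set_type A)) !=set0.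
  by apply: pq; exact: set_type_val_continuous.
by exists (val r).
Qed.

Lemma compact_set_type (X : topologicalType) (A : set X) :
  compact A -> compact [set: set_type A].
Proof.
move=> cA F FF _.
have [|x [Ax clx]] := cA (val @ F) (fmap_proper_filter _ FF).
  apply: (@filterS _ F _ setT) => [y _|]; last exact: filterT.
  exact: set_mem (valP y).
exists (exist _ x (mem_set Ax)); split=> // U V FU [_ [[W oW <-] /= Wx] sV].
have [||_ [[u Uu <-] Wu]] := clx (set_val @` U) W.
- by apply: (@filterS _ F _ U) => // u Uu; exists u.
- exact: open_nbhs_nbhs.
- by exists u; split=> //; exact: sV.
Qed.

Lemma homeomorphism_compact (X Y : topologicalType) (f : X -> Y) :
  compact [set: X] -> hausdorff_space Y -> continuous f -> bijective f ->
  homeomorphism f.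
Proof.
move=> cX hY cf [g fK gK]; split=> //; exists g; split=> //.
apply/continuous_closedP => A cA.
have -> : g @^-1` A = f @` A.
  by apply/seteqP; split=> [y Ay|_ [x Ax <-]] /=;
    [exists (g y) | rewrite fK].
apply: compact_closed => //; apply: continuous_compact.
  exact: continuous_subspaceT.
exact: subclosed_compact cA cX _.
Qed.

Lemma homeomorphism_comp (X Y Z : topologicalType) (f : X -> Y) (g : Y -> Z) :
  homeomorphism f -> homeomorphism g -> homeomorphism (g \o f).
Proof.
move=> [cf [f' [cf' fK fK']]] [cg [g' [cg' gK gK']]]; split.
  by move=> x; apply: continuous_comp; [exact: cf|exact: cg].
exists (f' \o g'); split.
- by move=> x; apply: continuous_comp; [exact: cg'|exact: cf'].
- by move=> x /=; rewrite gK fK.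
- by move=> x /=; rewrite fK' gK'.
Qed.

(** Case analysis is enough, without induction: apart from compactness, which [f] transports, both
    constructors see the space only through a homeomorphism out of it, and [f] can be composed with
    that. *)
Lemma class_R_homeo (R : realType) (X Y : topologicalType) (f : Y -> X) :
  homeomorphism f -> class_R R X -> class_R R Y.
Proof.
move=> hf RX; case: {X} RX f hf
  => [X cX [M [h hh]]|d I S X RS [wo cS rS [q [h hh qh]]]] f hf.
  apply: class_R_metrizable; last first.
    by exists M, (h \o f); exact: homeomorphism_comp.
  have [_ [g [cg fK gK]]] := hf.
  have -> : [set: Y] = g @` [set: X].
    by apply/seteqP; split=> // y _; exists (f y).
  by apply: continuous_compact => //; exact: continuous_subspaceT.
apply: (class_R_limit RS); split=> //.
exists (fun i => q i \o f), (h \o f); first exact: homeomorphism_comp.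
by move=> x i; rewrite /= qh.
Qed.

Lemma class_R_RC (R : realType) (X : topologicalType) :
  class_R R X -> class_RC R X.
Proof.
elim=> {X} [X|d I S X _]; first exact: class_RC_metrizable.
exact: class_RC_limit.
Qed.

Lemma continuous_to_prod_topology (X : topologicalType) (I : Type)
    (T : I -> topologicalType) (f : X -> prod_topology T) :
  (forall i, continuous (fun x => f x i)) -> continuous f.
Proof.
move=> cf x; apply/cvg_sup => i U [_ [[W oW <-] /= Wx] sU].
by apply: filterS sU _; apply: cf; exact: open_nbhs_nbhs.
Qed.

(** * Inverse limits along retractions of a compact space *)

(** By compactness of [X] it suffices that the canonical map to the Hausdorff space of threads is a
    continuous bijection. Injectivity is assumed, and surjectivity of the single projections lifts
    to threads by a second use of compactness. *)
Lemma is_inverse_limit_compact d (I : orderType d) (S : inverse_system I)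
    (D : set I) (X : topologicalType) (q : forall i, D i -> X -> S i) :
  compact [set: X] -> D !=set0 -> (forall i, hausdorff_space (S i)) ->
  (forall i Di, continuous (q i Di)) ->
  (forall i j Di Dj (ij : i <= j) x, bond ij (q j Dj x) = q i Di x) ->
  (forall i Di y, exists x, q i Di x = y) ->
  (forall x y, (forall i Di, q i Di x = q i Di y) -> x = y) ->
  is_inverse_limit q.
Proof.
move=> cX [i0 Di0] hS cq qB q_surj q_inj.
pose t x : prod_topology (fun i : D => S (val i)) :=
  fun i : D => q (val i) (set_mem (valP i)) x.
have tP x : t x \in threads S D by apply/mem_set => i j ij; exact: qB.
exists (fun x => exist _ (t x) (tP x)) => //.
apply: homeomorphism_compact => //.
- by apply/hausdorff_set_type/hausdorff_product => i; exact: hS.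
- apply: continuous_to_set_type; apply: continuous_to_prod_topology => i.
  exact: cq.
rewrite -setTT_bijective; split=> [//||].
  move=> x y _ _ /(congr1 val) /= txy; apply: q_inj => i Di.
  have := congr1 (fun u : prod_topology _ => u (exist _ i (mem_set Di))) txy.
  by rewrite /t /= ![set_mem _](Prop_irrelevance _ Di).
move=> [u uP] _ /=; have {}uP' := set_mem uP.
pose C (i : D) := [set x | t x i = u i].
have CP : ProperFilter (filter_from [set: D] C).
  apply: filter_from_proper; last first.
    by move=> i _; have [x xi] := q_surj _ (set_mem (valP i)) (u i); exists x.
  apply: filter_from_filter; first by exists (exist _ i0 (mem_set Di0)).
  have CS (i j : D) : val i <= val j -> C j `<=` C i.
    move=> ij x; rewrite /C /= => xj.
    by rewrite -(uP' _ _ ij) -xj /t (qB _ _ (set_mem (valP i))).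
  move=> i j _ _; have [/CS ij|/ltW/CS ji] := leP (val i) (val j).
    by exists j => // x Cx; split=> //; exact: ij.
  by exists i => // x Cx; split=> //; exact: ji.
have [|x [_]] := cX _ CP; first exact: filterT.
rewrite clusterE => clx; exists x => //; apply/val_inj => /=.
apply: functional_extensionality_dep => i.
have cC : closed (C i).
  have -> : C i = q (val i) (set_mem (valP i)) @^-1` [set u i] by [].
  apply: closed_comp => [y _|]; first exact: cq.
  by apply: accessible_closed_set1; exact/hausdorff_accessible.
by rewrite closure_id in cC; have := clx (C i); rewrite -cC; apply; exists i.
Qed.

Section limit_of_retracts.
Variables (X : topologicalType) (d : Order.disp_t) (I : orderType d).
Variable r : I -> X -> X.
Hypotheses (r_cont : forall i, continuous (r i))
  (rrl : forall i j x, i <= j -> r i (r j x) = r i x).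

Definition retract i := [set x | r i x = x].

Definition retract_map i (x : X) : set_type (retract i) :=
  exist _ (r i x) (mem_set (rrl x (lexx i))).

Lemma val_retract i (x : set_type (retract i)) : r i (val x) = val x.
Proof. exact: set_mem (valP x). Qed.

Lemma retract_map_continuous i : continuous (retract_map i).
Proof. by apply: continuous_to_set_type; exact: r_cont. Qed.

Definition retract_bond i j (_ : i <= j) (x : set_type (retract j)) :=
  retract_map i (val x).

Lemma retract_bond_continuous i j (ij : i <= j) :
  continuous (retract_bond ij).
Proof.
move=> x; apply: continuous_comp; first exact: set_type_val_continuous.
exact: retract_map_continuous.
Qed.

Lemma retract_bond_id i (ii : i <= i) x : retract_bond ii x = x.
Proof. by apply/val_inj/val_retract. Qed.

Lemma retract_bond_comp i j k (ij : i <= j) (jk : j <= k) (ik : i <= k) x :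
  retract_bond ij (retract_bond jk x) = retract_bond ik x.
Proof. by apply/val_inj/rrl. Qed.

Definition retract_system := InverseSystem retract_bond_continuous
  retract_bond_id retract_bond_comp.

(** Fixed points of [r i] need not be fixed by [r j], so the right inverse is a restriction of [r j]
    and not an inclusion. *)
Lemma retract_bond_retraction i j (ij : i <= j) : retraction (retract_bond ij).
Proof.
split; first exact: retract_bond_continuous.
exists (fun x => retract_map j (val x)).
  move=> x; apply: continuous_comp; first exact: set_type_val_continuous.
  exact: retract_map_continuous.
by move=> x; apply/val_inj; rewrite /= rrl // val_retract.
Qed.

(** The retracts form an inverse sequence with limit [X]. Projections onto retracts are surjective,
    so what remains is separation of points: by the earlier retractions at a limit index, which
    gives continuity of the sequence, and by all of them on [X]. *)
Lemma class_R_retracts (R : realType) :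
  compact [set: X] -> hausdorff_space X ->
  wochoice.well_order (fun i j : I => i <= j) -> [set: I] !=set0 ->
  (forall l x y, limit_index l -> (forall i, i < l -> r i x = r i y) ->
    r l x = r l y) ->
  (forall x y, (forall i, r i x = r i y) -> x = y) ->
  (forall i, class_R R (set_type (retract i))) -> class_R R X.
Proof.
move=> cX hX wo I0 r_lim r_sep RR.
have hS i : hausdorff_space (retract_system i) by exact: hausdorff_set_type.
have surj i (x : set_type (retract i)) : retract_map i (val x) = x.
  by apply/val_inj/val_retract.
apply: (@class_R_limit _ _ _ retract_system) => //; split=> //.
- move=> l ll; apply: is_inverse_limit_compact => //=.
  + have -> : [set: set_type (retract l)] = retract_map l @` [set: X].
      by apply/seteqP; split=> // x _; exists (val x).
    apply: continuous_compact => //; apply: continuous_subspaceT.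
    exact: retract_map_continuous.
  + by have [[i il] _] := ll; exists i.
  + by move=> i il; exact: retract_bond_continuous.
  + by move=> i j il jl ij x; apply: val_inj; exact: rrl.
  + move=> i il y; exists (retract_map l (val y)).
    by apply: val_inj; rewrite /= rrl ?val_retract // ltW.
  + move=> x y xy; apply/val_inj.
    have := r_lim l (val x) (val y) ll; rewrite !val_retract; apply=> i il.
    exact: (congr1 (fun u : set_type (retract i) => val u) (xy i il)).
- by move=> i j ij; exact: retract_bond_retraction.
- exists retract_map; apply: is_inverse_limit_compact => //.
  + by move=> i _; exact: retract_map_continuous.
  + by move=> i j _ _ ij x; apply: val_inj; exact: rrl.
  + by move=> i _ y; exists (val (y : set_type (retract i))); exact: surj.
  + by move=> x y xy; apply: r_sep => i;
      exact: (congr1 (fun u : set_type (retract i) => val u) (xy i Logic.I)).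
Qed.

End limit_of_retracts.

(** Flattens a subspace of a subspace. Fixed sets of retractions arise in the nested form, whereas
    [stably_R] speaks of subspaces of the ambient space. *)
Lemma homeomorphism_set_type_image (X : topologicalType) (F : set X)
    (G : set (set_type F)) :
  exists g : set_type G -> set_type (set_val @` G), homeomorphism g.
Proof.
have FP x : x \in set_val @` G -> x \in F.
  by move=> /set_mem[p _ <-]; exact: valP.
have GP x (xG : x \in set_val @` G) : exist _ x (FP x xG) \in G.
  have /set_mem[p Gp px] := xG.
  by rewrite (_ : exist _ _ _ = p); [exact/mem_set | exact/val_inj].
pose f (x : set_type (set_val @` G)) : set_type G :=
  exist _ (exist _ (val x) (FP _ (valP x))) (GP _ (valP x)).
have gP (y : set_type G) : set_val (val y) \in set_val @` G.
  by apply/mem_set; exists (val y) => //; exact: set_mem (valP y).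
pose g (y : set_type G) : set_type (set_val @` G) :=
  exist (fun x => x \in set_val @` G) _ (gP y).
exists g; split.
  apply: continuous_to_set_type => y.
  by apply: continuous_comp; exact: set_type_val_continuous.
exists f; split.
- do 2!apply: continuous_to_set_type; exact: set_type_val_continuous.
- by move=> y; do 2!apply: val_inj.
- by move=> x; exact: val_inj.
Qed.

(** * Cofinal well-ordered subsets, and suprema in compact orders *)

Lemma cofinal_well_ordered d (T : orderType d) (B : set T) :
  exists W : set T, [/\ W `<=` B, forall b, B b -> exists2 w, W w & b <= w &
    forall A : set T, A `<=` W -> A !=set0 ->
      exists2 a, A a & forall b, A b -> a <= b].
Proof.
have [le le_wo] := wochoice.well_ordering_principle T.
have le_min (A : set T) : A !=set0 -> exists2 a, A a & forall b, A b -> le a b.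
  move=> [x Ax]; have [|a [[Aa aP] _]] := le_wo (mem A).
    by exists x; exact: mem_set.
  by exists a; [exact: set_mem | move=> b Ab; apply/aP/mem_set].
(* On the records of a well-ordering [le], [le] and [<=] agree. *)
exists [set x | B x /\ forall y, B y -> le y x -> y <= x]; split.
- by move=> x [].
(* The [le]-first element [a] of [B] above [b] is a record: a [y] preceding and exceeding it would
   also lie above [b], hence equal [a]. *)
- move=> b Bb; have [|a [Ba ba] aP] := le_min [set x | B x /\ b <= x].
    by exists b.
  exists a => //; split=> // y By lya; rewrite leNgt; apply/negP => ay.
  have lay : le a y by apply: aP; split=> //; exact: le_trans (ltW ay).
  have /wochoice.wo_chain_antisymmetric anti :
    wochoice.wo_chain le (mem [set: T]) by move=> A _; exact: le_wo.
  have ya : y = a by apply: anti; rewrite ?in_setT ?lya.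
  by rewrite ya ltxx in ay.
- move=> A AW /le_min[a Aa aP]; exists a => // b Ab.
  by have [_ /(_ a)] := AW _ Ab; apply; [have [] := AW _ Aa | exact: aP].
Qed.

Section compact_order.
Context d (T : orderTopologicalType d).
Hypothesis cT : compact [set: T].

(** The tails of [A] generate a proper filter. As closed rays are closed sets, a cluster point lies
    above each element of [A] and below each upper bound. *)
Lemma compact_has_sup (A : set T) : A !=set0 ->
  exists s, ubound A s /\ forall b, ubound A b -> s <= b.
Proof.
move=> [a0 Aa0].
have CP : ProperFilter (filter_from A (fun a => A `&` `[a, +oo[)).
  apply: filter_from_proper => [|a Aa]; last first.
    by exists a; split; rewrite //= in_itv /= lexx.
  apply: filter_from_filter; first by exists a0.
  move=> a b Aa Ab; exists (Order.max a b); first by case: leP.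
  move=> x [Ax]; rewrite /= in_itv /= andbT ge_max => /andP[ax bx].
  by do 2!split=> //; rewrite /= in_itv /= andbT.
have [|s [_]] := cT CP; first exact: filterT.
rewrite clusterE => cls; exists s; split=> [a Aa|b bA].
  have : closure `[a, +oo[ s.
    apply: (closure_subset (@subIsetr _ A _)).
    by apply: (cls (A `&` `[a, +oo[)); exists a.
  by have /closure_id <- := @rray_closed _ T a; rewrite /= in_itv /= andbT.
have : closure `]-oo, b] s.
  apply: (@closure_subset _ A); first by move=> x /bA; rewrite /= in_itv.
  by apply: (cls A); exists a0 => // x [].
by have /closure_id <- := @lray_closed _ T b; rewrite /= in_itv.
Qed.

End compact_order.

(** A separate name for [set_type W] to carry the order induced from [T]; it indexes the inverse
    sequences below. *)
Definition sub_order d (T : orderType d) (W : set T) : Type := set_type W.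
HB.instance Definition _ d (T : orderType d) (W : set T) :=
  SubChoice.copy (sub_order W) (set_type W).
HB.instance Definition _ d (T : orderType d) (W : set T) :=
  [SubChoice_isSubOrder of sub_order W by <: with d].

(** * Intervals as limits of shorter intervals *)

Section good_sets.
Variables (R : realType) (X : topologicalType).

(* Quantifying over the finite sets [A] here, and over the disjoint sets [E] in
   [good], makes good sets closed under disjoint unions without any lemma on
   disjoint sums in the class R. *)
Definition stably_R (E : set X) :=
  closed E /\ forall A, finite_set A -> class_R R (set_type (E `|` A)).

Definition good (I : set X) :=
  forall E, E `&` I = set0 -> stably_R E -> stably_R (E `|` I).

End good_sets.

Section limit_step.
Variables (R : realType) (d : Order.disp_t) (T : orderTopologicalType d).
Hypothesis cT : compact [set: T].

(* On a set [E `|` `[u, s]] with [E] disjoint from `[u, s], this is a retraction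
   onto [E `|` `[u, t]]. *)
Definition clamp (u s t x : T) := if u <= x <= s then Order.min x t else x.

Lemma clamp_id (u s t x : T) :
  (clamp u s t x = x) <-> (u <= x <= s -> x <= t).
Proof.
rewrite /clamp; case: ifP => xI; last by split.
by split=> [e _|xt]; [rewrite -e ge_min lexx orbT | rewrite min_l ?xt].
Qed.

Lemma clamp_clamp (u s t t' x : T) : u <= t -> t <= t' -> t' <= s ->
  clamp u s t (clamp u s t' x) = clamp u s t x.
Proof.
move=> ut tt' t's; rewrite {2 3}/clamp.
have [/andP[ux xs]|/negbTE xI] := boolP (u <= x <= s); last first.
  by rewrite /clamp xI.
rewrite /clamp.
have -> : u <= Order.min x t' <= s.
  by rewrite le_min ux (le_trans ut tt') ge_min xs.
by rewrite -minA (min_r tt').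
Qed.

(** If the minima of [x] and [y] with [t] differed, the smaller one would be a point below [t], and
    a [j] above it would already tell [x] and [y] apart. If just one of the two lies in [u, s],
    clamping keeps it there, so a single [j] gives a contradiction. *)
Lemma clamp_sup (u s t x y : T) (J : set T) : J !=set0 ->
  (forall j, J j -> u <= j <= s) ->
  (forall z, z < t -> exists2 j, J j & z < j) ->
  (forall j, J j -> clamp u s j x = clamp u s j y) ->
  clamp u s t x = clamp u s t y.
Proof.
have min_le (a b : T) : (forall z, z < t -> exists2 j, J j & z < j) ->
    (forall j, J j -> Order.min a j = Order.min b j) ->
    Order.min b t <= Order.min a t.
  move=> J_cof Jab; rewrite leNgt; apply/negP => ab.
  have [ta|at_] := leP t a.
    by move: ab; rewrite (min_r ta) lt_min ltxx andbF.
  move: ab; rewrite (min_l (ltW at_)) lt_min => /andP[ab _].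
  have [j Jj aj] := J_cof _ at_.
  have := Jab _ Jj; rewrite (min_l (ltW aj)) => e.
  by have : a < Order.min b j; [rewrite lt_min ab | rewrite -e ltxx].
move=> [j0 Jj0] JI J_cof; rewrite /clamp => Jxy.
have clampI (a j : T) : J j -> u <= a <= s -> u <= Order.min a j <= s.
  by move=> /JI/andP[uj js] /andP[ua as_]; rewrite le_min ua uj ge_min as_.
have := Jxy _ Jj0.
case: ifP => xI; case: ifP => yI.
- move=> _; apply/le_anti/andP; split; apply: min_le => // j /Jxy;
  by rewrite xI yI.
- by move=> e; rewrite -e clampI in yI.
- by move=> e; rewrite e clampI in xI.
- by [].
Qed.

(** The domain is the union of the closed pieces [E], [u, t] and [t, s]; the clamp is the identity
    on the first two and constant on the third. *)
Lemma clamp_continuous (E : set T) (u s t : T)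
    (f : set_type (E `|` `[u, s]) -> set_type (E `|` `[u, s])) :
  closed E -> E `&` `[u, s] = set0 ->
  u <= t <= s -> (forall x, val (f x) = clamp u s t (val x)) -> continuous f.
Proof.
move=> cE EI /andP[ut ts] fE; apply: continuous_to_set_type.
have -> : val \o f = clamp u s t \o val by apply/funext => x; exact: fE.
apply/continuous_closedP => C cC.
have -> : (clamp u s t \o val) @^-1` C =
    (val : set_type (E `|` `[u, s]) -> T) @^-1`
      (E `&` C `|` (`[u, t] `&` C `|` `[t, s] `&` [set _ | C t])).
  apply/seteqP; split=> -[x xF] /=; rewrite /clamp !in_itv /=.
    have [Ex|xI] := set_mem xF.
      rewrite ifF; first by left.
      apply/negP => xI; suff : (E `&` `[u, s]) x by rewrite EI.
      by split=> //; rewrite /= in_itv.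
    move: xI; rewrite /= in_itv /= => xI; rewrite xI.
    case/andP: xI => ux xs; case: (leP x t) => [xt|tx] Cx.
      by right; left; rewrite ux.
    by right; right; rewrite xs (ltW tx).
  move=> [[Ex Cx]|[[/andP[ux xt] Cx]|[/andP[tx xs] Ct]]].
  - rewrite ifF //.
    apply/negP => xI; suff : (E `&` `[u, s]) x by rewrite EI.
    by split=> //; rewrite /= in_itv.
  - by rewrite ux (le_trans xt ts) min_l.
  - by rewrite xs (le_trans ut tx) min_r.
apply: closed_comp => [x _|]; first exact: set_type_val_continuous.
apply: closedU; first exact: closedI.
apply: closedU; first by apply: closedI => //; exact: itv_closed.
apply: closedI; first exact: itv_closed.
have [Ct|Ct] := pselect (C t).
  have -> : [set _ : T | C t] = setT by apply/seteqP; split.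
  exact: closedT.
have -> : [set _ : T | C t] = set0 by apply/seteqP; split.
exact: closed0.
Qed.

(** The clamps at an increasing chain of points [t w] with supremum [s] retract the whole set onto
    smaller ones, in which [u, s] is replaced by [u, t w]. These are in the class R because [u, t w]
    is good. *)
Lemma good_limit (u s : T) : u < s ->
  (forall x, x < s -> exists y, x < y < s) ->
  (forall t, u <= t < s -> good R `[u, t]) -> good R `[u, s].
Proof.
move=> us s_lim t_good E EI [cE RE]; split.
  by apply: closedU => //; exact: itv_closed.
(* Points of [A] inside [u, s] are present anyway; the others join [E] in [E'], where every clamp
   fixes them. *)
move=> A finA; pose A' := A `\` `[u, s].
have finA' : finite_set A' by apply: sub_finite_set finA => x [].
pose E' := E `|` A'.
have cE' : closed E'.
  apply: closedU => //; have T1 := hausdorff_accessible (@order_hausdorff _ T).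
  by have /accessible_finite_set_closed := T1; apply.
have E'I : E' `&` `[u, s] = set0.
  by rewrite setIUl EI set0U; apply/seteqP; split=> x // [[]].
pose F := E' `|` `[u, s].
have -> : E `|` `[u, s] `|` A = F.
  apply/seteqP; split=> x; last first.
    by move=> [[?|[? _]]|?]; [left; left|right|left; right].
  move=> [[?|?]|Ax]; [by left; left|by right|].
  by have [?|?] := pselect (`[u, s] x); [right | left; right].
have [W [WB W_cof W_min]] := @cofinal_well_ordered _ T [set x | u <= x < s].
(* Including [u] makes [D w] nonempty even for the least [w] and keeps its supremum at or above
   [u]. *)
pose D w := [set v | v = u \/ W v /\ v < w].
(* Unlike W itself, the suprema t w form a continuous chain. *)
have /choice[t tP] w :
    exists t, ubound (D w) t /\ forall b, ubound (D w) b -> t <= b.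
  by apply: (compact_has_sup cT); exists u; left.
have ut w : u <= t w by have [h _] := tP w; apply: h; left.
have tW w : W w -> t w <= w.
  move=> /WB /= /andP[uw ws]; have [_] := tP w; apply=> v [->//|[_ /ltW]//].
have ts w : W w -> t w < s.
  by move=> Ww; apply: le_lt_trans (tW w Ww) _; have /andP[] := WB _ Ww.
have t_mono v w : v <= w -> t v <= t w.
  move=> vw; have [_] := tP v; apply=> x [->|[Wx xv]]; first exact: ut.
  by have [h _] := tP w; apply: h; right; split=> //; exact: lt_le_trans xv vw.
have le_t v w : W v -> v < w -> v <= t w.
  by move=> Wv vw; have [h _] := tP w; apply: h; right.
have W_next x : x < s -> exists2 w, W w & x < w.
  move=> xs; have [y /andP[xy ys]] := s_lim _ xs.
  have [|w Ww yw] := W_cof (Order.max y u).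
    by rewrite /= le_max lexx orbT gt_max ys.
  exists w => //; apply: lt_le_trans xy _; apply: le_trans yw.
  by rewrite le_max lexx.
have FP w (x : set_type F) : W w -> clamp u s (t w) (val x) \in F.
  move=> Ww; apply/mem_set; rewrite /clamp; case: ifP => [/andP[ux xs]|_].
    by right; rewrite /= in_itv /= le_min ux ut ge_min xs.
  exact: set_mem (valP x).
pose r (i : sub_order W) (x : set_type F) : set_type F :=
  exist (fun y => y \in F) _ (FP (val i) x (set_mem (valP i))).
have Wi (i : sub_order W) : W (val i) := set_mem (valP i).
have cF : closed F by apply: closedU => //; exact: itv_closed.
apply: (@class_R_retracts _ _ _ r) => //.
- move=> i; apply: (@clamp_continuous E' u s (t (val i))) => //.
  by rewrite ut ltW // ts.
- move=> i j x ij; apply: val_inj; apply: clamp_clamp; first exact: ut.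
    exact: t_mono.
  exact/ltW/ts.
- by apply: compact_set_type; exact: subclosed_compact cF cT _.
- exact/hausdorff_set_type/order_hausdorff.
- apply: wochoice.antisymmetric_well_order; first exact: le_anti.
  move=> A0 [a0 Aa0].
  have [||_ [a Aa <-] aP] := W_min (val @` [set i | i \in A0]).
  + by move=> _ [i _ <-].
  + by exists (val a0), a0.
  by exists a; split=> // b Ab; apply: (aP (val b)); exists b.
- have [|w Ww _] := W_cof u; first by rewrite /= lexx us.
  by exists (exist _ w (mem_set Ww)).
- move=> l x y [[i0 i0l] l_lim] xy; apply: val_inj => /=.
  apply: (@clamp_sup _ _ _ _ _ [set t (val i) | i in [set i | i < l]]).
  + by exists (t (val i0)), i0.
  + by move=> _ [i _ <-]; rewrite ut ltW // ts.
  (* A point [z] below [t l] is below some [v] in [D l]. If [v] is not [u], the limit index [l]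
     leaves room for a [j] between [v] and [l], and then [v <= t j]. *)
  + move=> z zl; have [v Dv zv] : exists2 v, D (val l) v & z < v.
      apply: contrapT => zD; move: zl; rewrite ltNge => /negP; apply.
      have [_] := tP (val l); apply=> v Dv; rewrite leNgt.
      by apply/negP => zv; apply: zD; exists v.
    case: Dv => [vu|[Wv vl]].
      by exists (t (val i0)); [exists i0 | rewrite (lt_le_trans zv) // vu ut].
    pose i : sub_order W := exist _ v (mem_set Wv).
    have [j /andP[ij jl]] := l_lim i vl.
    exists (t (val j)); first by exists j.
    exact: lt_le_trans zv (le_t v (val j) Wv ij).
  + move=> _ [i il <-].
    exact: (congr1 (fun z : set_type F => val z) (xy i il)).
- move=> x y xy; apply: val_inj => /=.
  (* As clamping at [s] is the identity, separation of points is the case [t = s] of [clamp_sup]. *)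
  have clamp_s (z : T) : clamp u s s z = z by apply/clamp_id => /andP[].
  rewrite -(clamp_s (val x)) -(clamp_s (val y)).
  apply: (@clamp_sup _ _ _ _ _ [set t (val i) | i in [set: sub_order W]]).
  + have [w Ww _] := W_next u us.
    by exists (t w), (exist _ w (mem_set Ww)).
  + by move=> _ [i _ <-]; rewrite ut ltW // ts.
  + move=> z /W_next[v Wv zv]; have /andP[_ /W_next[w Ww vw]] := WB _ Wv.
    exists (t w); first by exists (exist _ w (mem_set Ww)).
    exact: lt_le_trans zv (le_t _ _ Wv vw).
  + by move=> _ [i _ <-]; exact: (congr1 (fun z : set_type F => val z) (xy i)).
- move=> i; have [f hf] := homeomorphism_set_type_image (retract r i).
  apply: class_R_homeo hf _.
  (* In this form the goodness of [u, t i] applies to [E], with [A'] as the finite set that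
     [stably_R] allows. *)
  have -> : set_val @` retract r i = E `|` `[u, t (val i)] `|` A'.
    apply/seteqP; split=> [_ [x /(congr1 val)/clamp_id xt <-]|x].
      have [[Ex|Ax]|xI] := set_mem (valP x).
      - by left; left.
      - by right.
      left; right.
      move: xI xt; rewrite /= !in_itv /= => /[dup] /andP[-> _] xI; exact.
    move=> Ex.
    have xt : u <= x <= s -> x <= t (val i).
      move=> xI; case: Ex => [[Ex|]|[Ax Ax']].
      - suff : (E `&` `[u, s]) x by rewrite EI.
        by split=> //; rewrite /= in_itv.
      - by rewrite /= in_itv /= => /andP[].
      - by exfalso; apply: Ax'; rewrite /= in_itv.
    have xF : x \in F.
      apply/mem_set; case: Ex => [[Ex|]|Ax]; [by left; left| |by left; right].
      rewrite /= in_itv /= => /andP[ux xi]; right; rewrite /= in_itv /= ux.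
      exact: le_trans xi (ltW (ts _ (Wi i))).
    by exists (exist _ x xF) => //; apply: val_inj; exact/clamp_id.
  have [||_ RE'] := t_good (t (val i)) _ E _ (conj cE RE).
  + by rewrite ut ts.
  + apply/seteqP; split=> // x [Ex]; rewrite /= in_itv /= => /andP[ux xi].
    have <- : (E `&` `[u, s]) x = False by rewrite EI.
    split=> //; rewrite /= in_itv /= ux.
    exact: le_trans xi (ltW (ts _ (Wi i))).
  + exact: RE'.
Qed.

End limit_step.

(** * Reversal of the order, which turns suprema into infima and left limits into right limits *)

Section dual_order_topology.
Variables (d : Order.disp_t) (T : orderTopologicalType d).

HB.instance Definition _ := Topological.copy (T^d) T.

(** Exchanging the two bounds of an interval and negating the side of each gives the same set of
    points as an interval of the reversed order, and open ends stay open. *)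
Lemma dual_itv_nbhsE (x : T^d) : nbhs x = filter_from
  (fun i : interval T^d => itv_open_ends i /\ x \in i) (fun i => [set` i]).
Proof.
have -> : nbhs x = @nbhs T T x by [].
pose f (b : itv_bound T) : itv_bound T^d := match b with
  | BSide b y => BSide (~~ b) (y : T^d) | BInfty b => BInfty _ (~~ b) end.
pose g (b : itv_bound T^d) : itv_bound T := match b with
  | BSide b y => BSide (~~ b) (y : T) | BInfty b => BInfty _ (~~ b) end.
have fE l r (y : T) :
    ((y : T^d) \in Interval (f r) (f l)) = (y \in Interval l r).
  by case: l r => [[]l|[]] [[]r|[]];
    rewrite !in_itv /= ?leEdual ?ltEdual // andbC.
have gE l r (y : T) :
    (y \in Interval (g r) (g l)) = ((y : T^d) \in Interval l r).
  by case: l r => [[]l|[]] [[]r|[]];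
    rewrite !in_itv /= ?leEdual ?ltEdual // andbC.
rewrite itv_nbhsE; apply/seteqP; split=> U [[l r] [oi xi] iU].
  exists (Interval (f r) (f l)); last by move=> y /=; rewrite fE; exact: iU.
  by rewrite fE; split=> //; move: l r oi {xi iU} => [[]l|[]] [[]r|[]].
exists (Interval (g r) (g l)); last by move=> y /=; rewrite gE; exact: iU.
by rewrite gE; split=> //; move: l r oi {xi iU} => [[]l|[]] [[]r|[]].
Qed.

HB.instance Definition _ := Order_isNbhs.Build _ (T^d) dual_itv_nbhsE.

End dual_order_topology.

Section dual_compact.
Variables (R : realType) (d : Order.disp_t) (T : orderTopologicalType d).
Hypothesis cT : compact [set: T].

Lemma compact_has_inf (A : set T) : A !=set0 ->
  exists s, lbound A s /\ forall b, lbound A b -> b <= s.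
Proof. exact: (@compact_has_sup _ (T^d : orderTopologicalType _) cT). Qed.

Lemma good_limit_left (u s : T) : u < s ->
  (forall x, u < x -> exists y, u < y < x) ->
  (forall t, u < t <= s -> good R `[t, s]) -> good R `[u, s].
Proof.
have dualE (a b : T) :
    `[a, b] = [set` Interval (BSide true (b : T^d)) (BSide false (a : T^d))].
  by apply/seteqP; split=> x; rewrite /= !in_itv /= !leEdual andbC.
move=> us u_lim t_good; rewrite dualE.
apply: (@good_limit R _ (T^d : orderTopologicalType _) cT s u us) => [x xu|t].
  by have [y] := u_lim x xu; exists y; rewrite andbC.
by rewrite -dualE => st; apply: t_good; rewrite andbC.
Qed.

End dual_compact.

(** * Embedding the rationals *)

Lemma seq_extremum (A : eqType) (r : rel A) (p : pred A) (s : seq A) :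
  total r -> transitive r -> (forall x, x \in s -> ~~ p x) \/
  exists2 k, k \in s & p k /\ forall x, x \in s -> p x -> r x k.
Proof.
move=> r_tot r_trans; have r_refl x : r x x by have := r_tot x x; rewrite orbb.
elim: s => [|a s IH]; first by left.
have [pa|pa] := boolP (p a); last first.
  case: IH => [Np|[k ks [pk kP]]]; [left|right].
    by move=> x; rewrite inE => /predU1P[->|/Np].
  exists k; rewrite ?inE ?ks ?orbT //; split=> // x.
  by rewrite inE => /predU1P[->|/kP//]; rewrite (negPf pa).
right; case: IH => [Np|[k ks [pk kP]]].
  exists a; rewrite ?inE ?eqxx //; split=> // x.
  by rewrite inE => /predU1P[->|/Np/negPf->].
have [ak|ka] := orP (r_tot a k).
  exists k; rewrite ?inE ?ks ?orbT //; split=> // x.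
  by rewrite inE => /predU1P[->|/kP].
exists a; rewrite ?inE ?eqxx //; split=> // x.
rewrite inE => /predU1P[->//|xs /(kP _ xs) xk]; exact: r_trans xk ka.
Qed.

Section rat_embedding.
Variables (d : Order.disp_t) (T : orderType d) (P : T -> T -> Prop).
Hypotheses (P_lt : forall x y, P x y -> x < y)
  (P_trans : forall x y z, P x y -> P y z -> P x z)
  (P_dense : forall x y, P x y -> exists z, P x z /\ P z y).
Variables (a0 b0 : T).
Hypothesis P0 : P a0 b0.

(* A finite partial map, listed by its graph. *)
Definition partial_embedding (s : seq (rat * T)) :=
  (forall u, u \in s -> P a0 u.2 /\ P u.2 b0) /\
  (forall u v, u \in s -> v \in s ->
     (u.1 < v.1 -> P u.2 v.2) /\ (u.1 = v.1 -> u.2 = v.2)).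

(** The new value is chosen by [P_dense] between [l], the value at the last argument before [q], and
    [h], the value at the first one after [q], with [a0] and [b0] as defaults. Transitivity of [P]
    relates it to all other values. *)
Lemma partial_embedding_extend s q : partial_embedding s ->
  exists s', [/\ partial_embedding s', {subset s <= s'} &
    exists a, (q, a) \in s'].
Proof.
move=> [sB sP].
have [[a qa]|Nq] := pselect (exists a, (q, a) \in s).
  by exists s; split=> //; exists a.
have [l [l0 lP lu]] : exists l, [/\ P l b0,
    (forall u, u \in s -> u.1 < q -> P u.2 l \/ u.2 = l) /\ (P a0 l \/ a0 = l) &
    forall u, u \in s -> q < u.1 -> P l u.2].
  have [||Nl|[k ks [/= kq kP]]] := @seq_extremum _
    (fun u v : rat * T => u.1 <= v.1) (fun u => u.1 < q) s.
  - by move=> u v; exact: le_total.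
  - by move=> u v w; exact: le_trans.
  - exists a0; split=> // [|u us _]; last by have [] := sB _ us.
    by split; [move=> u /Nl/negPf->|right].
  - exists k.2; split=> [||u us qu]; first by have [] := sB _ ks.
      split=> [u us uq|]; last by left; have [] := sB _ ks.
      have [uk ek] := sP _ _ us ks.
      have := kP u us uq; rewrite le_eqVlt.
      by move=> /predU1P[/ek|/uk]; [right|left].
    by have [h _] := sP _ _ ks us; apply: h; exact: lt_trans kq qu.
have [h [lh hP hb]] : exists h, [/\ P l h,
    forall u, u \in s -> q < u.1 -> P h u.2 \/ u.2 = h & P h b0 \/ h = b0].
  have [||Nl|[k ks [/= kq kP]]] := @seq_extremum _
    (fun u v : rat * T => v.1 <= u.1) (fun u => q < u.1) s.
  - by move=> u v; exact: le_total.
  - by move=> u v w vu uw; exact: le_trans uw vu.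
  - by exists b0; split=> // [u /Nl/negPf->|] //; right.
  - exists k.2; split; first exact: lu.
      move=> u us uq; have [ku ek] := sP _ _ ks us.
      have := kP u us uq; rewrite le_eqVlt => /predU1P[/ek|/ku]; last by left.
      by right.
    by left; have [] := sB _ ks.
have [c [lc ch]] := P_dense lh.
have clo u : u \in s -> u.1 < q -> P u.2 c.
  by move=> us uq; case: lP => /(_ u us uq) [ul|->] _ //; exact: P_trans ul lc.
have chi u : u \in s -> q < u.1 -> P c u.2.
  by move=> us uq; case: (hP u us uq) => [hu|->] //; exact: P_trans ch hu.
have neq u : u \in s -> u.1 <> q.
  by move=> us uq; apply: Nq; exists u.2; rewrite -uq -surjective_pairing.
exists ((q, c) :: s); split; last by exists c; rewrite inE eqxx.
- split=> [u|u v].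
    rewrite inE => /predU1P[->/=|/sB//]; split.
      by case: lP => _ [a0l|->] //; exact: P_trans a0l lc.
    by case: hb => [hb|<-] //; exact: P_trans ch hb.
  rewrite !inE => /predU1P[->/=|us] /predU1P[->/=|vs]; last exact: sP.
  + by rewrite ltxx.
  + by split=> [|/esym/(neq _ vs)//]; exact: chi.
  + by split=> [|/(neq _ us)//]; exact: clo.
- by move=> u us; rewrite inE us orbT.
Qed.

Lemma rat_embedding : exists f : rat -> T, {mono f : x y / x <= y}.
Proof.
have /choice[F FP] (sq : seq (rat * T) * rat) : exists s',
    partial_embedding sq.1 -> [/\ partial_embedding s', {subset sq.1 <= s'} &
      exists a, (sq.2, a) \in s'].
  have [/(@partial_embedding_extend _ sq.2)[s' s'P]|Nv] :=
    pselect (partial_embedding sq.1); first by exists s'.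
  (* An arbitrary value for inputs that are not partial embeddings; the stages [S n] never meet
     it. *)
  by exists [::].
(* Stage [m.+1] treats the rational with code [m], so [q] has a value from stage [(pickle q).+1] on.
   Numbers that code no rational change nothing. *)
pose fix S n := if n is m.+1 then
  if unpickle m is Some q then F (S m, q) else S m else [::].
have SP n : partial_embedding (S n).
  elim: n => [|n IH] //=; case: (unpickle n) => [q|] //.
  by have [] := FP (S n, q) IH.
have S1 n : {subset S n <= S n.+1}.
  move=> u /=; case: (unpickle n) => [q|] //.
  by have [_ + _] := FP (S n, q) (SP n); apply.
have S_mono m n : (m <= n)%N -> {subset S m <= S n}.
  move=> mn u um; elim: n mn => [|n IH]; first by rewrite leqn0 => /eqP <-.
  by rewrite leq_eqVlt => /predU1P[<-//|/IH/S1].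
have /choice[f fP] (q : rat) : exists a, (q, a) \in S (pickle q).+1.
  by rewrite /= pickleK; have [_ _] := FP (S (pickle q), q) (SP _).
exists f; apply: le_mono => x y xy.
set n := maxn (pickle x).+1 (pickle y).+1.
have [_ /(_ (x, f x) (y, f y))[]] := SP n.
- by apply: S_mono (fP x); exact: leq_maxl.
- by apply: S_mono (fP y); exact: leq_maxr.
by move=> /(_ xy)/P_lt.
Qed.

End rat_embedding.

(** * Metrizability of finite spaces *)

Definition discrete_metric (T : Type) : Type := T.

Section discrete_metric.
Variables (R : realType) (T : choiceType).
Implicit Types x y z : T.
Local Open Scope ring_scope.

Definition discrete_dist x y : R := (x != y)%:R.

Lemma discrete_distxx x : discrete_dist x x = 0.
Proof. by rewrite /discrete_dist eqxx. Qed.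

Lemma discrete_dist_eq0 x y : discrete_dist x y = 0 -> x = y.
Proof.
rewrite /discrete_dist; case: eqVneq => //= _ /eqP.
by rewrite GRing.oner_eq0.
Qed.

Lemma discrete_distC x y : discrete_dist x y = discrete_dist y x.
Proof. by rewrite /discrete_dist eq_sym. Qed.

Lemma discrete_dist_triangle y x z :
  discrete_dist x z <= discrete_dist x y + discrete_dist y z.
Proof.
rewrite /discrete_dist -GRing.natrD Num.Theory.ler_nat.
by have [->|] := eqVneq x y; [|rewrite (leq_trans (leq_b1 _)) // leq_addr].
Qed.

HB.instance Definition _ := Choice.copy (discrete_metric T) T.
HB.instance Definition _ := isMetric.Build R (discrete_metric T)
  discrete_distxx discrete_dist_eq0 discrete_distC discrete_dist_triangle.

End discrete_metric.

Lemma metrizable_discrete (R : realType) (X : topologicalType) :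
  (forall A : set X, open A) -> metrizable R X.
Proof.
move=> oX; exists (discrete_metric X : metricType R), id; split.
  by apply/continuousP => A _; exact: oX.
exists id; split=> // x U /nbhs_singleton Ux.
apply/(@nbhs_ballP R (discrete_metric X : metricType R)).
(* Distances are 0 or 1, so the open ball of radius 1 is a singleton. *)
exists 1%R => [|y] /=; first exact: Num.Theory.ltr01.
rewrite ballEmdist /= /mdist /= /discrete_dist.
by have [<-//|_] := eqVneq; rewrite ltxx.
Qed.

Lemma class_R_finite (R : realType) (X : topologicalType) :
  accessible_space X -> finite_set [set: X] -> class_R R X.
Proof.
move=> /accessible_finite_set_closed X1 fX.
apply: class_R_metrizable; first exact: finite_compact.
apply: metrizable_discrete => A; rewrite -closedC; apply: X1.
exact: sub_finite_set (@subsetT _ _) fX.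
Qed.

(** * Linked points *)

(** The set [I] is absorbed into the finite sets over which [stably_R] quantifies. *)
Lemma good_finite (R : realType) (T : topologicalType) (I : set T) :
  accessible_space T -> finite_set I -> good R I.
Proof.
move=> T1 fI E _ [cE RE]; split.
  by apply: closedU => //; have /accessible_finite_set_closed := T1; apply.
by move=> A fA; rewrite -setUA; apply: RE; rewrite finite_setU.
Qed.

Section components.
Variables (R : realType) (d : Order.disp_t) (T : orderTopologicalType d).
Hypothesis cT : compact [set: T].
Hypothesis jump : forall q : T,
  (exists2 p, p < q & forall x, ~ (p < x < q)) \/
  (exists2 r, q < r & forall x, ~ (q < x < r)).

Definition linked (p q : T) :=
  forall u v, p <= u -> u <= v -> v <= q -> good R `[u, v].

Lemma linked_sub p q p' q' : p <= p' -> q' <= q -> linked p q -> linked p' q'.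
Proof.
move=> pp' q'q pq u v p'u uv vq'.
by apply: pq => //; [exact: le_trans p'u | exact: le_trans q'q].
Qed.

(** The jump makes [u, z] the disjoint union of [u, v] and [w, z], which can be added to [E] one
    after the other. *)
Lemma good_cat (u v w z : T) : u <= v -> v < w -> w <= z ->
  (forall x, ~ (v < x < w)) -> good R `[u, v] -> good R `[w, z] ->
  good R `[u, z].
Proof.
move=> uv vw wz vw_adj uvP wzP E EI RE.
have uz : `[u, z] = `[u, v] `|` `[w, z].
  apply/seteqP; split=> x; rewrite /= !in_itv /=.
    move=> /andP[ux xz]; have [xv|vx] := leP x v; first by left; rewrite ux.
    right; rewrite xz andbT leNgt; apply/negP => xw.
    by apply: (vw_adj x); rewrite vx.
  move=> [/andP[ux xv]|/andP[wx xz]].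
    by rewrite ux (le_trans xv) // ltW // (lt_le_trans vw).
  by rewrite xz andbT (le_trans uv) // ltW // (lt_le_trans vw).
have NEI x : E x -> ~ `[u, z] x.
  by move=> Ex xI; suff : (E `&` `[u, z]) x by rewrite EI.
rewrite uz in NEI *; rewrite setUA; apply: wzP; last first.
  by apply: uvP => //; apply/seteqP; split=> // x [/NEI + xI]; case; left.
apply/seteqP; split=> // x [[/NEI + xI|]]; first by case; right.
rewrite /= !in_itv /= => /andP[_ xv] /andP[wx _].
by move: (lt_le_trans vw (le_trans wx xv)); rewrite ltxx.
Qed.

(** Intervals inside [a, b] have no points besides [a] and [b], so they are finite. The case [a = b]
    gives reflexivity. *)
Lemma linked_adjacent a b : a <= b -> (forall x, ~ (a < x < b)) -> linked a b.
Proof.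
move=> ab adj u v au uv vb.
apply: good_finite; first exact/hausdorff_accessible/order_hausdorff.
apply: (@sub_finite_set _ _ [set a; b]); last exact: finite_set2.
move=> x; rewrite /= in_itv /= => /andP[ux xv].
have [->|xa] := eqVneq x a; first by left.
have [->|xb] := eqVneq x b; first by right.
case: (adj x); rewrite !lt_neqAle eq_sym xa xb /=.
by rewrite (le_trans au ux) (le_trans xv vb).
Qed.

(* The jump at [q] is needed: glueing two intervals at a common point would
   require right inverses of the bonding maps that preserve this point. *)
Lemma linked_trans p q r : linked p q -> linked q r -> linked p r.
Proof.
move=> pq qr u v pu uv vr.
have [vq|qv] := leP v q; first exact: pq.
have [qu|uq] := leP q u; first exact: qr.
have [[q' q'q adj]|[q' qq' adj]] := jump q.
  have uq' : u <= q'.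
    by rewrite leNgt; apply/negP => ?; apply: (adj u); apply/andP.
  apply: (good_cat uq' q'q (ltW qv) adj).
    by apply: pq => //; exact: ltW.
  by apply: qr => //; exact: ltW.
have q'v : q' <= v.
  by rewrite leNgt; apply/negP => ?; apply: (adj v); apply/andP.
apply: (good_cat (ltW uq) qq' q'v adj).
  by apply: pq => //; exact: ltW.
by apply: qr => //; exact: ltW.
Qed.

(** If [s] has an immediate predecessor, linkedness passes through it by transitivity. Otherwise [s]
    is a limit from the left, and only the intervals ending at [s] are new; [good_limit] handles
    those. *)
Lemma linked_sup p s : p <= s ->
  (forall t, p <= t < s -> linked p t) -> linked p s.
Proof.
rewrite le_eqVlt => /predU1P[->|ps] pt.
  by apply: linked_adjacent => // x /andP[sx /(lt_trans sx)]; rewrite ltxx.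
have [[x xs adj]|s_lim] := pselect (exists2 x, x < s & forall y, ~ (x < y < s)).
  have px : p <= x.
    by rewrite leNgt; apply/negP => ?; apply: (adj p); apply/andP.
  apply: (@linked_trans _ x); first by apply: pt; rewrite px.
  exact: linked_adjacent (ltW xs) adj.
move=> u v pu; rewrite le_eqVlt => /predU1P[<-|uv].
  move=> us; apply: (@linked_adjacent u u) => // x /andP[ux].
  by move=> /(lt_trans ux); rewrite ltxx.
rewrite le_eqVlt => /predU1P[vs|vs]; last first.
  by apply: (pt v) => //; [rewrite vs (le_trans pu) // ltW | exact: ltW].
rewrite vs in uv *; apply: (good_limit cT uv) => [x xs|t /andP[ut ts]].
  apply: contrapT => Nx; apply: s_lim; exists x => // y xy.
  by apply: Nx; exists y.
by apply: (pt t); rewrite // (le_trans pu).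
Qed.

Lemma linked_inf s q : s <= q ->
  (forall t, s < t <= q -> linked t q) -> linked s q.
Proof.
rewrite le_eqVlt => /predU1P[->|sq] qt.
  by apply: linked_adjacent => // x /andP[sx /(lt_trans sx)]; rewrite ltxx.
have [[x sx adj]|s_lim] := pselect (exists2 x, s < x & forall y, ~ (s < y < x)).
  have xq : x <= q.
    by rewrite leNgt; apply/negP => ?; apply: (adj q); apply/andP.
  apply: (@linked_trans _ x); last by apply: qt; rewrite sx.
  exact: linked_adjacent (ltW sx) adj.
move=> u v + + vq; rewrite le_eqVlt => /predU1P[<-|su]; last first.
  by move=> uv; apply: (qt u) => //; rewrite su (le_trans uv).
rewrite le_eqVlt => /predU1P[<-|sv].
  apply: (@linked_adjacent s s) => // x /andP[sx].
  by move=> /(lt_trans sx); rewrite ltxx.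
apply: (good_limit_left cT sv) => [x sx|t /andP[st tv]].
  apply: contrapT => Nx; apply: s_lim; exists x => // y xy.
  by apply: Nx; exists y.
by apply: (qt t); rewrite // st (le_trans tv).
Qed.

(** Let [s] be the last point to which [p] is linked and [i] the first one linked to [q]; both exist
    by [linked_sup] and [linked_inf]. If [i <= s], or if nothing lay between [s] and [i],
    transitivity would link [p] to [q]. Any [t] strictly between them is as required. *)
Lemma linked_dense p q : p < q -> ~ linked p q ->
  exists t, (p < t /\ ~ linked p t) /\ (t < q /\ ~ linked t q).
Proof.
move=> pq Npq.
have linked_refl x : linked x x.
  apply: linked_adjacent => // y /andP[xy /(lt_trans xy)]; by rewrite ltxx.
have [|s [sub sle]] :=
    compact_has_sup cT (A := [set t | p <= t <= q /\ linked p t]).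
  by exists p; split; [rewrite lexx ltW | exact: linked_refl].
have [|i [ilb ige]] :=
    compact_has_inf cT (A := [set t | p <= t <= q /\ linked t q]).
  by exists q; split; [rewrite lexx ltW | exact: linked_refl].
have ps : p <= s by apply: sub; split; [rewrite lexx ltW | exact: linked_refl].
have iq : i <= q by apply: ilb; split; [rewrite lexx ltW | exact: linked_refl].
have Lps : linked p s.
  apply: linked_sup => // t /andP[pt ts].
  have [t' [_ pt'] tt'] :
      exists2 t', [set t | p <= t <= q /\ linked p t] t' & t <= t'.
    apply: contrapT => Nt; move: ts; rewrite ltNge; case/negP; apply: sle.
    move=> x xA; rewrite leNgt; apply/negP => tx; apply: Nt.
    by exists x => //; exact: ltW.
  exact: linked_sub (lexx p) tt' pt'.
have Liq : linked i q.
  apply: linked_inf => // t /andP[it tq].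
  have [t' [_ t'q] t't] :
      exists2 t', [set t | p <= t <= q /\ linked t q] t' & t' <= t.
    apply: contrapT => Nt; move: it; rewrite ltNge; case/negP; apply: ige.
    move=> x xA; rewrite leNgt; apply/negP => tx; apply: Nt.
    by exists x => //; exact: ltW.
  exact: linked_sub t't (lexx q) t'q.
have si : s < i.
  rewrite ltNge; apply/negP => si; apply: Npq; apply: linked_trans Liq.
  exact: linked_sub (lexx p) si Lps.
have [t /andP[st ti]] : exists t, s < t < i.
  apply: contrapT => Nt; apply: Npq; apply: linked_trans Lps _.
  apply: linked_trans Liq; apply: linked_adjacent (ltW si) _ => t st.
  by apply: Nt; exists t.
have pt := le_lt_trans ps st; have tq := lt_le_trans ti iq.
exists t; split; split=> // Lt.
- move: st; rewrite ltNge => /negP; apply; apply: sub; split=> //.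
  by rewrite !ltW.
- move: ti; rewrite ltNge => /negP; apply; apply: ilb; split=> //.
  by rewrite !ltW.
Qed.

Lemma class_R_scattered : scattered T -> class_R R T.
Proof.
move=> scT; have T1 : accessible_space T.
  exact/hausdorff_accessible/order_hausdorff.
have [T0|/set0P[x0 _]] := eqVneq [set: T] set0.
  by apply: class_R_finite => //; rewrite T0.
have [q [qub _]] := compact_has_sup cT (A := setT) (ex_intro _ x0 Logic.I).
have [p [plb _]] := compact_has_inf cT (A := setT) (ex_intro _ x0 Logic.I).
have pq : p <= q by exact: qub.
have [Lpq|Npq] := pselect (linked p q); last first.
  case: scT.
  apply: (@rat_embedding _ _ (fun x y => x < y /\ ~ linked x y) _ _ _ p q).
  - by move=> x y [].
  - move=> x y z [xy Nxy] [yz _]; split; first exact: lt_trans yz.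
    by move=> Lxz; apply: Nxy; exact: linked_sub (lexx x) (ltW yz) Lxz.
  - by move=> x y [xy Nxy]; exact: linked_dense.
  - split=> //; rewrite lt_neqAle pq andbT; apply/eqP => e; apply: Npq.
    rewrite e; apply: linked_adjacent => // x /andP[qx /(lt_trans qx)].
    by rewrite ltxx.
(* Goodness of the whole space is used with [E] and [A] empty; the empty set is stably in R because
   finite spaces are in R. *)
have [||_ /(_ set0 (finite_set0 _))] := Lpq p q (lexx p) pq (lexx q) set0.
- by rewrite set0I.
- split; first exact: closed0.
  move=> A fA; rewrite set0U; apply: class_R_finite.
    exact/hausdorff_accessible/hausdorff_set_type/order_hausdorff.
  rewrite -(eq_finite_set (inj_card_eq (f := set_val) _)); last first.
    by move=> x y _ _; exact: val_inj.
  by apply: sub_finite_set fA => _ [x _ <-]; exact: set_mem (valP x).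
rewrite set0U setU0 => RT; have pqT (x : T) : x \in (`[p, q] : set T).
  by apply/mem_set; rewrite /= in_itv /= plb // qub.
pose f (x : T) : set_type (`[p, q] : set T) := exist _ x (pqT x).
apply: (@class_R_homeo _ _ _ f) RT; split.
  by apply: continuous_to_set_type => x.
exists val; split=> //; first exact: set_type_val_continuous.
by move=> y; exact: val_inj.
Qed.

End components.

(** * The double arrow space *)

Lemma order_cvg d (T : orderTopologicalType d) (F : set_system T) (x : T) :
  Filter F -> (forall l, l < x -> F `]l, +oo[) ->
  (forall r, x < r -> F `]-oo, r[) -> F --> x.
Proof.
move=> FF Fl Fr U; rewrite itv_nbhsE => -[[l r] [oi xi] iU].
apply: (filterS iU); move: l r oi xi {iU} => [[]l|[]] [[]r|[]] //= _;
  rewrite in_itv /= ?andbT.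
- move=> /andP[lx xr]; rewrite set_itv_splitI.
  by apply: filterI; [exact: Fl|exact: Fr].
- exact: Fl.
- exact: Fr.
- by move=> _; rewrite set_itvE; exact: filterT.
Qed.

Lemma order_continuous (X : topologicalType) d (T : orderTopologicalType d)
    (f : X -> T) : (forall a, open (f @^-1` `]a, +oo[)) ->
  (forall b, open (f @^-1` `]-oo, b[)) -> continuous f.
Proof.
move=> fl fr x; apply: order_cvg => [l lx|r xr];
  apply: open_nbhs_nbhs; split=> //.
by rewrite /= in_itv /= lx.
Qed.

Section double_arrow.
Variables (d : Order.disp_t) (K : orderTopologicalType d).

(** Since [false < true], each [k] is split into a left copy [(k, false)] and a right copy
    [(k, true)], which form a jump. *)
Definition double_arrow := order_topology (K *l bool).
HB.instance Definition _ := OrderTopological.on double_arrow.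

Definition double_fst (x : double_arrow) : K := x.1.

Lemma double_le (x y : double_arrow) :
  (x <= y) = (x.1 <= y.1) && ((y.1 <= x.1) ==> (x.2 <= y.2)).
Proof. by []. Qed.

Lemma double_lt (x y : double_arrow) :
  (x < y) = (x.1 < y.1) || ((x.1 == y.1) && ((~~ x.2) && y.2)).
Proof.
rewrite ltNge double_le negb_and negb_imply -!ltNge.
by case: x y => [x1 []] [y1 []] /=; case: ltgtP.
Qed.

Lemma double_fst_homo : {homo double_fst : x y / x <= y}.
Proof. by move=> x y; rewrite double_le => /andP[]. Qed.

(** The preimage of the open ray above [a] is the open ray above the right copy of [a], and dually
    with the left copy. *)
Lemma double_fst_continuous : continuous double_fst.
Proof.
apply: order_continuous => a.
  have -> : double_fst @^-1` `]a, +oo[ = `](a, true) : double_arrow, +oo[.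
    by apply/seteqP; split=> x;
      rewrite /= !in_itv /= !andbT double_lt /= ?andbF ?orbF.
  exact: rray_open.
have -> : double_fst @^-1` `]-oo, a[ = `]-oo, (a, false) : double_arrow[.
  by apply/seteqP; split=> x; rewrite /= !in_itv /= double_lt /= ?andbF ?orbF.
exact: lray_open.
Qed.

Lemma double_fst_surj : range double_fst = [set: K].
Proof. by apply/seteqP; split=> // k _; exists (k, true). Qed.

Lemma double_fst_two_to_one : two_to_one double_fst.
Proof.
move=> k _.
have -> : double_fst @^-1` [set k] =
    [set ((k, false) : double_arrow); (k, true)].
  by apply/seteqP; split=> [[k' []] /= ->|x [] -> //]; [right|left].
have <- : (fun n => (k, n == 1%N) : double_arrow) @` `I_2 =
    [set ((k, false) : double_arrow); (k, true)].
  apply/seteqP; split=> [_ [[|[|//]] _ <-]|x]; [by left|by right|].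
  by case=> ->; [exists 0%N|exists 1%N].
apply: inj_card_eq => -[|[|m]] [|[|n]] /set_mem //= _ /set_mem //.
Qed.

Lemma double_adjacent (k : K) (x : double_arrow) :
  ~ (((k, false) : double_arrow) < x < ((k, true) : double_arrow)).
Proof. by rewrite !double_lt; case: x => x [] /=; case: (ltgtP k x). Qed.

Lemma double_jump (q : double_arrow) :
  (exists2 p, p < q & forall x, ~ (p < x < q)) \/
  (exists2 r, q < r & forall x, ~ (q < x < r)).
Proof.
by case: q => k []; [left; exists (k, false)|right; exists (k, true)];
  try exact: double_adjacent; rewrite double_lt /= eqxx orbT.
Qed.

(** An embedding of the rationals stays injective after projection: if [x < y] had the same image,
    their midpoint would give a third point in a fibre of two points. *)
Lemma double_scattered : scattered K -> scattered double_arrow.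
Proof.
move=> scK [f f_mono]; apply: scK; exists (double_fst \o f); apply: le_mono.
move=> x y xy; rewrite lt_neqAle double_fst_homo ?f_mono ?(ltW xy) // andbT.
apply/eqP => e.
have {}e : double_fst (f x) = double_fst (f y) := e.
have /= [xz zy] := Num.Theory.midf_lt xy; set z := ((_ / _)%R) in xz zy.
have f_lt := leW_mono f_mono.
have /double_fst_homo fxz : f x <= f z by rewrite f_mono ltW.
have /double_fst_homo fzy : f z <= f y by rewrite f_mono ltW.
have fz : double_fst (f z) = double_fst (f x).
  by apply/le_anti; rewrite fxz andbT e.
have : f x < f z by rewrite f_lt.
have : f z < f y by rewrite f_lt.
rewrite !double_lt -!/(double_fst _) fz -e ltxx eqxx /=.
by move=> /andP[/negPf-> _]; rewrite andbF.
Qed.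

(** The projection of an ultrafilter [F] converges to some [k], so [F] contains every open ray whose
    endpoint lies over another point and which contains the fibre of [k]. Whether [F] contains the
    closed ray up to [(k, false)] decides which copy of [k] is its limit. *)
Lemma double_compact : compact [set: K] -> compact [set: double_arrow].
Proof.
move=> cK; rewrite compact_ultra => F FU _.
have [|k [_ clk]] := cK (double_fst @ F) _; first exact: filterT.
have Fk V : nbhs k V -> F (double_fst @^-1` V).
  move=> kV; have [//|FNV] := in_ultra_setVsetC (double_fst @^-1` V) FU.
  have [||_ [[x NVx <-] Vx]] := clk (double_fst @` (~` (double_fst @^-1` V))) V.
  - by apply: (@filterS _ F _ (~` (double_fst @^-1` V))) => // x NVx; exists x.
  - exact: kV.
  - by case: NVx.
have Fl (a : double_arrow) : a.1 < k -> F `]a, +oo[.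
  move=> ak; apply: (@filterS _ F _ (double_fst @^-1` `]a.1, +oo[)).
    by move=> x; rewrite /= !in_itv /= !andbT double_lt => ->.
  apply: Fk; apply: open_nbhs_nbhs; split; first exact: rray_open.
  by rewrite /= in_itv /= ak.
have Fr (b : double_arrow) : k < b.1 -> F `]-oo, b[.
  move=> kb; apply: (@filterS _ F _ (double_fst @^-1` `]-oo, b.1[)).
    by move=> x; rewrite /= !in_itv /= double_lt => ->.
  apply: Fk; apply: open_nbhs_nbhs; split; first exact: lray_open.
  by rewrite /= in_itv.
have [FL|FNL] := in_ultra_setVsetC `]-oo, ((k, false) : double_arrow)] FU.
  exists (k, false); split=> //; apply: order_cvg => [l|r kr].
    by rewrite double_lt /= !andbF orbF; exact: Fl.
  apply: (@filterS _ F _ `]-oo, ((k, false) : double_arrow)]) => // x.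
  by rewrite /= !in_itv /= => /le_lt_trans; apply.
exists (k, true); split=> //; apply: order_cvg => [l lk|r]; last first.
  by rewrite double_lt /= andbF orbF; exact: Fr.
apply: (@filterS _ F _ (~` `]-oo, ((k, false) : double_arrow)])) => // x.
rewrite /= !in_itv /= andbT => /negP; rewrite -ltNge => kx.
rewrite ltNge; apply/negP => xl; apply: (@double_adjacent k x).
by rewrite kx (le_lt_trans xl).
Qed.

End double_arrow.

Theorem corollary5p4 (R : realType) (d : Order.disp_t)
    (K : orderTopologicalType d) :
  compact [set: K] -> scattered K ->
  (exists (d' : Order.disp_t) (L : orderTopologicalType d') (f : L -> K),
     [/\ compact [set: L], scattered L & class_R R L] /\
     [/\ continuous f, {homo f : x y / x <= y}, two_to_one f
       & range f = [set: K]]) /\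
  class_RC R K.
Proof.
move=> cK scK; have cL := double_compact cK; have scL := double_scattered scK.
have RL : class_R R (double_arrow K).
  by apply: class_R_scattered => //; exact: double_jump.
split; last first.
  apply: (@class_RC_image _ (double_arrow K) K (@double_fst _ K)).
  - exact: class_R_RC.
  - exact: double_fst_continuous.
  - exact: double_fst_surj.
  - exact: order_hausdorff.
exists _, (double_arrow K : orderTopologicalType _), (@double_fst _ K).
split; split=> //.
- exact: double_fst_continuous.
- exact: double_fst_homo.
- exact: double_fst_two_to_one.
- exact: double_fst_surj.
Qed.
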